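(* Let $G$ be a finite group that is a split extension of an abelian normal subgroup $N$, and suppose that $G/N$ is supersoluble. Suppose that for each prime $p$ there is a Sylow $p$-subgroup $S$ of $G$ such that any two complements of $S\cap N$ in $S$ are conjugate in $G$. Then any two complements of $N$ in $G$ are conjugate in $G$.
   Context: A subgroup $K$ of a group $X$ is a complement of a normal subgroup $M$ of $X$ if $MK=X$ and $M\cap K=1$. The group $G$ is a split extension of a normal subgroup $N$ if $N$ has a complement in $G$. Two subgroups $A,B$ of $G$ are conjugate in $G$ if $B=g^{-1}Ag$ for some $g\in G$. A group $X$ is supersoluble if it possesses a series $1=X_0\leq X_1\leq\dots\leq X_s=X$ with each $X_i$ normal in $X$ and each quotient $X_{i+1}/X_i$ cyclic for $0\leq i<s$. *)

(* Defs.v *)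
From mathcomp Require Import all_boot all_fingroup all_solvable.

Set Implicit Arguments.
Unset Strict Implicit.
Unset Printing Implicit Defensive.

Import GroupScope.

(* The sequence s lists X_1, ..., X_m; the initial term X_0 = 1 is the starting
   point of the path. The step condition only mentions normality in X of the
   upper term, since X_0 = 1 is always normal in X. *)
Definition supersoluble (gT : finGroupType) (X : {group gT}) : Prop :=
  exists2 s : seq {group gT},
    path (fun U V : {group gT} => [&& U \subset V, V <| X & cyclic (V / U)])
         1%G s
    & last 1%G s = X.

(* A :^ g is the set g^-1 A g. *)
Definition conjugate_in (gT : finGroupType) (G A B : {group gT}) : Prop :=
  exists2 g, g \in G & B :=: A :^ g.

(* Main.v *)
Require Import Defs.
From mathcomp Require Import all_boot all_fingroup all_solvable.

Set Implicit Arguments.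
Unset Strict Implicit.
Unset Printing Implicit Defensive.

Import GroupScope.

(** Let H and K be complements of N in G. For a prime p write
    N = 'O_p(N) \x 'O_p^'(N). Absorbing the p'-part of N into H and K gives
    complements 'O_p^'(N) H and 'O_p^'(N) K of the abelian p-group 'O_p(N),
    which lies in the Sylow subgroup S. They meet S in complements of
    'O_p(N) = S :&: N in S, and these are conjugate in G by hypothesis.

    That conjugation can be realised inside 'O_p(N)
    ([conj_setI_complements]), so after replacing H by an 'O_p(N)-conjugate the
    two large complements agree on S, and Gaschutz's transitivity theorem makes
    them conjugate under 'O_p(N) ([Gaschutz_conj]). In cohomological terms, the
    restriction from G / N to its Sylow subgroup S N / N is injective on
    H^1(G / N, 'O_p(N)).

    This gives, for each prime p, some y in 'O_p(N) with H :^ y contained in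
    'O_p^'(N) K ([conj_sub_pcoreC_mul]). The elements found for different
    primes do not disturb each other, because 'O_p(N) lies in 'O_q^'(N) for
    q != p; hence their product x in N satisfies H :^ x \subset 'O_p^'(N) K for
    all p at once ([conj_sub_all_pcoreC_mul]). As the N-component of an element
    of N K is unique, that of an element of H :^ x lies in every 'O_p^'(N), so
    it is trivial and H :^ x = K. *)

Section Complements.

Variable gT : finGroupType.
Implicit Types (A B G H K L M N S : {group gT}) (p q : nat).

Lemma complement_setI G M L S :
    M \subset S -> S \subset G -> L \in [complements to M in G] ->
  (L :&: S)%G \in [complements to M in S].
Proof.
move=> sMS sSG /complP[tiML defG]; apply/complP; split=> /=.
  by rewrite setIA tiML; apply/setIidPl/sub1G.
by rewrite group_modl // defG; apply/setIidPr.
Qed.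

Lemma complementJ G N H x :
    N <| G -> x \in G -> H \in [complements to N in G] ->
  (H :^ x)%G \in [complements to N in G].
Proof.
move=> nsNG Gx /complP[tiNH defG].
have nNx: N :^ x = N by apply: (normP (subsetP (normal_norm nsNG) x Gx)).
apply/complP; split=> /=; first by rewrite -{1}nNx -conjIg tiNH conjs1g.
by rewrite -{1}nNx -conjsMg defG conjGid.
Qed.

Lemma complement_dprod_join G N A B H :
    A \x B = N -> B <| G -> H \in [complements to N in G] ->
  (B <*> H)%G \in [complements to A in G].
Proof.
move=> /dprodP[_ defN _ tiAB] /andP[_ nBG] /complP[tiNH defG].
have sHG: H \subset G by rewrite -defG mulG_subr.
have sAN: A \subset N by rewrite -defN; apply: mulG_subl.
have sBN: B \subset N by rewrite -defN; apply: mulG_subr.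
have defBH := norm_joinEr (subset_trans sHG nBG).
apply/complP; split=> /=; last by rewrite defBH mulgA defN.
apply/trivgP; rewrite /= defBH -tiAB subsetI subsetIl /=.
apply: subset_trans (setSI _ sAN) _.
by rewrite setIC -group_modl // setIC tiNH mulg1.
Qed.

(** The conjugating element of G factors as h * m with h in L1 and m in M.
    Since m lies in S, the factor h maps L1 :&: S into L1 :&: S, hence onto it,
    so m alone does the conjugation. *)
Lemma conj_setI_complements G M L1 L2 S :
    M <| G -> M \subset S -> L1 \in [complements to M in G] ->
    conjugate_in G (L1 :&: S)%G (L2 :&: S)%G ->
  exists2 m, m \in M & L2 :&: S = (L1 :&: S) :^ m.
Proof.
move=> /andP[_ nMG] sMS /complP[_ defG] [g Gg /= defL2].
have sL1G: L1 \subset G by rewrite -defG mulG_subr.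
have: g \in L1 * M.
  by rewrite (normC (subset_trans sL1G nMG)) defG.
case/mulsgP=> h m L1h Mm def_g; exists m => //.
have Sm: m \in S := subsetP sMS m Mm.
suffices /eqP defL1: (L1 :&: S) :^ h == L1 :&: S.
  by rewrite defL2 def_g conjsgM defL1.
rewrite eqEcard cardJg leqnn andbT subsetI.
rewrite -{2}(conjGid L1h) conjSg subsetIl /=.
by rewrite -(conjSg _ _ m) -conjsgM -def_g -defL2 (conjGid Sm) subsetIr.
Qed.

Lemma Gaschutz_conj G M L1 L2 S :
    M <| G -> abelian M -> M \subset S -> S \subset G ->
    coprime #|M| #|G : S| ->
    L1 \in [complements to M in G] -> L2 \in [complements to M in G] ->
    conjugate_in G (L1 :&: S)%G (L2 :&: S)%G ->
  exists2 m, m \in M & L2 :=: L1 :^ m.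
Proof.
move=> nsMG abM sMS sSG coMS cL1 cL2 conjS.
have [m Mm defS] := conj_setI_complements nsMG sMS cL1 conjS.
have Gm: m \in G := subsetP (normal_sub nsMG) m Mm.
have cL1m := complementJ nsMG Gm cL1.
have eqS: (L1 :^ m)%G :&: S = L2 :&: S.
  by rewrite defS conjIg (conjGid (subsetP sMS m Mm)).
have [n Mn defL2] :=
  Gaschutz_transitive nsMG sMS sSG abM coMS cL1m cL2 eqS.
by exists (m * n); rewrite ?groupM // conjsgM.
Qed.

Definition Sylow_complements_conj G N p :=
  exists2 S : {group gT}, p.-Sylow(G) S &
    forall A B : {group gT},
      A \in [complements to S :&: N in S] ->
      B \in [complements to S :&: N in S] -> conjugate_in G A B.

(** The p-part of the theorem: H and K become conjugate modulo 'O_p^'(N), by an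
    element of 'O_p(N). The location of that element is what allows different
    primes to be treated one after the other. *)
Lemma conj_sub_pcoreC_mul G N H K p :
    N <| G -> abelian N -> Sylow_complements_conj G N p ->
    H \in [complements to N in G] -> K \in [complements to N in G] ->
  exists2 y, y \in 'O_p(N) & H :^ y \subset 'O_p^'(N) * K.
Proof.
move=> nsNG abN [S sylS conjS] cH cK.
have sSG := pHall_sub sylS.
have nilN := abelian_nil abN.
have nsOG pi: 'O_pi(N) <| G := gFnormal_trans _ nsNG.
have defSN: S :&: N = 'O_p(N).
  apply: (nilpotent_Hall_pcore nilN).
  exact: Hall_setI_normal nsNG sylS.
have sOS: 'O_p(N) \subset S by rewrite -defSN subsetIl.
have cJoin L: L \in [complements to N in G] ->
    ('O_p^'(N) <*> L)%G \in [complements to 'O_p(N) in G].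
  by apply: complement_dprod_join; [apply: nilpotent_pcoreC | apply: nsOG].
have coOS: coprime #|'O_p(N)| #|G : S|.
  by case/and3P: sylS => _ _; apply: pnat_coprime (pcore_pgroup p N).
have [|y Oy defK] := Gaschutz_conj (nsOG p) (abelianS (pcore_sub p N) abN)
  sOS sSG coOS (cJoin H cH) (cJoin K cK).
  by apply: conjS; rewrite defSN; apply: complement_setI sOS sSG _;
    apply: cJoin.
have sKG: K \subset G by case/complP: cK => _ <-; apply: mulG_subr.
exists y => //; rewrite -norm_joinEr; last first.
  exact: subset_trans sKG (normal_norm (nsOG _)).
by rewrite /= in defK; rewrite defK conjSg joing_subr.
Qed.

Lemma conj_sub_all_pcoreC_mul G N H K (s : seq nat) :
    N <| G -> abelian N -> uniq s ->
    {in s, forall p, Sylow_complements_conj G N p} ->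
    H \in [complements to N in G] -> K \in [complements to N in G] ->
  exists2 x, x \in N & {in s, forall p, H :^ x \subset 'O_p^'(N) * K}.
Proof.
move=> nsNG abN + + cH cK; elim: s => [|p s IHs] /=; first by exists 1.
case/andP=> s'p uniq_s conj_s.
have [q s_q|x Nx sHxK] := IHs uniq_s.
  by apply: conj_s; rewrite inE s_q orbT.
have Gx: x \in G := subsetP (normal_sub nsNG) x Nx.
have [y Oy sHxyK] := conj_sub_pcoreC_mul nsNG abN (conj_s p (mem_head p s))
  (complementJ nsNG Gx cH) cK.
exists (x * y); first by rewrite groupM // (subsetP (pcore_sub p N)).
move=> q; rewrite inE conjsgM => /predU1P[-> // | s_q].
(* The p-element y lies in 'O_q^'(N), so conjugation by y preserves the
   subgroup 'O_q^'(N) K. *)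
have nOK: K \subset 'N('O_q^'(N)).
  have sKG: K \subset G by case/complP: cK => _ <-; apply: mulG_subr.
  exact: subset_trans sKG (normal_norm (gFnormal_trans _ nsNG)).
have Oy': y \in 'O_q^'(N).
  apply: subsetP Oy; apply: sub_pcore => r; rewrite !inE => /eqP->.
  by apply: contraNneq s'p => ->.
have Jy: y \in 'O_q^'(N) <*> K by apply: subsetP Oy'; apply: joing_subl.
rewrite -norm_joinEr // -(conjGid Jy) conjSg /= norm_joinEr //.
exact: sHxK.
Qed.

Lemma pcoreC_all_trivg N x :
  {in primes #|N|, forall p, x \in 'O_p^'(N)} -> x \in N -> x = 1.
Proof.
move=> Ox Nx; apply/eqP; rewrite -order_eq1; apply: contraT => x_neq1.
have pr_p: prime (pdiv #[x]).
  by rewrite pdiv_prime // ltn_neqAle eq_sym x_neq1 order_gt0.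
have p_N: pdiv #[x] \in primes #|N|.
  rewrite mem_primes pr_p cardG_gt0.
  exact: dvdn_trans (pdiv_dvd _) (order_dvdG Nx).
have := mem_p_elt (pcore_pgroup _ N) (Ox _ p_N).
by rewrite /p_elt p'natE // pdiv_dvd.
Qed.

End Complements.

Theorem corollary1 (gT : finGroupType) (G N : {group gT})
    (nsNG : N <| G)
    (abN : abelian N)
    (splGN : [splits G, over N])
    (ssGN : supersoluble (G / N)%G)
    (sylconj : forall p : nat, prime p ->
       exists2 S : {group gT}, p.-Sylow(G) S &
         forall A B : {group gT},
           A \in [complements to S :&: N in S] ->
           B \in [complements to S :&: N in S] ->
           conjugate_in G A B)
    (H K : {group gT}) :
  H \in [complements to N in G] ->
  K \in [complements to N in G] ->
  conjugate_in G H K.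
Proof.
move=> cH cK.
have [p|x Nx sHxK] :=
  conj_sub_all_pcoreC_mul nsNG abN (primes_uniq #|N|) _ cH cK.
  by rewrite mem_primes => /andP[pr_p _]; apply: sylconj.
have Gx: x \in G := subsetP (normal_sub nsNG) x Nx.
have [tiNH defHx] := complP (complementJ nsNG Gx cH).
have [tiNK defG] := complP cK.
exists x => //; apply/esym/eqP; rewrite eqEcard; apply/andP; split; last first.
  rewrite -(leq_pmul2l (cardG_gt0 N)) -(TI_cardMg tiNK) -(TI_cardMg tiNH).
  by rewrite defG defHx.
apply/subsetP=> h Hxh.
have: h \in N * K by rewrite defG -defHx (subsetP (mulG_subr _ _)).
case/mulsgP=> n k Nn Kk def_h; rewrite def_h.
suffices ->: n = 1 by rewrite mul1g.
apply: (pcoreC_all_trivg _ Nn) => p /sHxK/subsetP/(_ h Hxh).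
case/mulsgP=> n' k' On' Kk' def_h'.
have Nn' : n' \in N := subsetP (pcore_sub _ _) n' On'.
rewrite -(divgrMid tiNK Nn Kk) -def_h def_h'.
by rewrite divgrMid.
Qed.
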